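(* Let $G=(V,E)$ be a finite, simple, connected graph with $|V|=k$ and $|E|\geq 2$, and let $\mathcal{G}_G$ be its graph automaton group. Then the following properties hold. (1) $\mathcal{G}_G$ is fractal. (2) $\mathcal{G}_G$ contains a nontrivial element of finite order and is non-abelian. (3) If $G$ contains a cycle with edges $e_1,\ldots,e_t$, then $(e_1^{\varepsilon_1}\cdots e_t^{\varepsilon_t})^{t-1}=id$ in $\mathcal{G}_G$ whenever $\varepsilon_i\in\{\pm1\}$ are such that $e_1^{\varepsilon_1},\ldots,e_t^{\varepsilon_t}$ is a directed cycle in $G$. (4) $\mathcal{G}_G$ is weakly regular branch over its commutator subgroup $\mathcal{G}_G'$.
   Context: Graph automaton group: given a finite simple graph $G=(V,E)$, choose an orientation of every edge and let $E'$ be the resulting set of ordered pairs. Let $V^n$ be the set of words of length $n$ over the alphabet $V$ and $V^*=\bigcup_{n\ge 0}V^n$. Each oriented edge $e=(x,y)\in E'$ acts as a length-preserving bijection of $V^*$ defined recursively by $e(\emptyset)=\emptyset$, $e(xw)=y\,e(w)$, $e(yw)=xw$, and $e(zw)=zw$ for $z\in V\setminus\{x,y\}$, $w\in V^*$. The group $\mathcal{G}_G$ is the group of bijections of $V^*$ generated by the elements of $E'$. The oppositely oriented edge $(y,x)$ defines the inverse bijection, so $e^{-1}$ denotes both the inverse group element and the reversed edge, and $\mathcal{G}_G$ does not depend on the orientation. Product convention: $gh$ means first apply $g$, then $h$. Restrictions: for $g\in\mathcal{G}_G$ and $x\in V$ there is a unique $g_x\in\mathcal{G}_G$ with $g(xw)=g(x)g_x(w)$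 for all $w\in V^*$. Let $Stab(V)=\{g\in\mathcal{G}_G: g(x)=x\ \forall x\in V\}$ and let $\psi:Stab(V)\to\mathcal{G}_G^{k}$, $\psi(g)=(g_x)_{x\in V}$. $\mathcal{G}_G$ is fractal if for each $x\in V$ the map $Stab(V)\to\mathcal{G}_G$, $g\mapsto g_x$, is surjective. $\mathcal{G}_G$ is weakly regular branch over a subgroup $N$ if $N$ is nontrivial and $N^k\subseteq\psi(N\cap Stab(V))$. A directed cycle of length $t$ is a sequence of oriented edges $(v_0,v_1),(v_1,v_2),\ldots,(v_{t-1},v_t)$ with $v_t=v_0$; here it traverses a cycle of the simple graph $G$ (so $v_0,\ldots,v_{t-1}$ are distinct and $t\ge3$). *)

(* Defs.v *)
From HB Require Import structures.
From mathcomp Require Import all_boot.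
From mathcomp Require Import boolp classical_sets.

Set Implicit Arguments.
Unset Strict Implicit.
Unset Printing Implicit Defensive.

Local Open Scope group_scope.

Section Groups.
Variable G : groupType.
Implicit Types A H : set G.

Definition is_subgroup H : Prop :=
  [/\ H 1, forall x y, H x -> H y -> H (x * y) & forall x, H x -> H x^-1].

Definition generated A : set G := smallest is_subgroup A.

Definition commutator_subgroup H : set G :=
  generated [set g | exists x y, [/\ H x, H y & g = [~ x, y]]]%classic.

Lemma generated_subgroup A : is_subgroup (generated A).
Proof.
split=> [H [[]] // | x y Gx Gy H HP | x Gx H HP]; have [[_ HM HV] _] := HP.
- by apply: HM; [apply: Gx | apply: Gy].
- by apply: HV; apply: Gx.
Qed.

End Groups.

(** The group of all bijections of the set [seq V] of finite words over [V]. *)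

Record wperm (V : Type) := WPerm {
  wfun :> seq V -> seq V;
  winv : seq V -> seq V;
  wfunK : cancel wfun winv;
  winvK : cancel winv wfun }.

Lemma wpermP (V : Type) (s t : wperm V) : (forall w, s w = t w) -> s = t.
Proof.
case: s t => [f f' fK f'K] [g g' gK g'K] /= fg.
have efg : f = g by apply: funext.
have efg' : f' = g'.
  by apply: funext => w; rewrite -[in LHS](g'K w) -efg fK.
by subst g g'; rewrite (Prop_irrelevance fK gK) (Prop_irrelevance f'K g'K).
Qed.

HB.instance Definition _ (V : Type) := gen_eqMixin (wperm V).
HB.instance Definition _ (V : Type) := gen_choiceMixin (wperm V).

Section WordPermGroup.
Variable V : Type.
Implicit Types s t : wperm V.

Definition wperm_one : wperm V := @WPerm V id id (fun=> erefl) (fun=> erefl).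

Definition wperm_inv s : wperm V := WPerm (@winvK V s) (@wfunK V s).

(** [s * t] means: first [s], then [t]. *)
Definition wperm_mul s t : wperm V :=
  WPerm (can_comp (@wfunK V t) (@wfunK V s))
        (can_comp (@winvK V s) (@winvK V t)).

Lemma wperm_mulA : associative wperm_mul.
Proof. by move=> s t u; apply: wpermP. Qed.

Lemma wperm_mul1 : left_id wperm_one wperm_mul.
Proof. by move=> s; apply: wpermP. Qed.

Lemma wperm_mulr1 : right_id wperm_one wperm_mul.
Proof. by move=> s; apply: wpermP. Qed.

Lemma wperm_mulV : left_inverse wperm_one wperm_inv wperm_mul.
Proof. by move=> s; apply: wpermP => w /=; rewrite winvK. Qed.

Lemma wperm_mulrV : right_inverse wperm_one wperm_inv wperm_mul.
Proof. by move=> s; apply: wpermP => w /=; rewrite wfunK. Qed.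

HB.instance Definition _ := isGroup.Build (wperm V)
  wperm_mulA wperm_mul1 wperm_mulr1 wperm_mulV wperm_mulrV.

Lemma wpermM s t w : (s * t) w = t (s w). Proof. by []. Qed.
Lemma wperm1 w : (1 : wperm V) w = w. Proof. by []. Qed.
Lemma wpermV s w : s^-1 w = winv s w. Proof. by []. Qed.

End WordPermGroup.

Section Graph.
Variable V : finType.
Implicit Types (adj : rel V) (D : {set V * V}) (x y : V) (w : seq V).

(** A simple graph on [V] is given by its (symmetric, irreflexive) adjacency
    relation; its edges are the corresponding unordered pairs. *)
Definition edge_set adj : {set {set V}} :=
  [set [set p.1; p.2] | p : V * V & adj p.1 p.2].

Definition orientation adj D : Prop :=
  (forall x y, adj x y = ((x, y) \in D) || ((y, x) \in D)) /\
  (forall x y, ~~ (((x, y) \in D) && ((y, x) \in D))).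

Definition rev_edge (e : V * V) : V * V := (e.2, e.1).

Fixpoint edge_fun (e : V * V) w : seq V :=
  if w is z :: w' then
    if z == e.1 then e.2 :: edge_fun e w'
    else if z == e.2 then e.1 :: w'
    else z :: w'
  else [::].

Lemma edge_funK e : cancel (edge_fun e) (edge_fun (rev_edge e)).
Proof.
case: e => x y; elim=> //= z w IHw.
have [->|zx] := eqVneq z x; first by rewrite /= eqxx IHw.
have [zy|zy] := eqVneq z y; last by rewrite /= (negbTE zy) (negbTE zx).
by rewrite /= -zy eq_sym (negbTE zx) eqxx.
Qed.

Lemma rev_edgeK : involutive rev_edge. Proof. by case. Qed.

Lemma edge_fun_revK e : cancel (edge_fun (rev_edge e)) (edge_fun e).
Proof. by move=> w; rewrite -{1}(rev_edgeK e) edge_funK. Qed.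

Definition edge_perm (e : V * V) : wperm V :=
  WPerm (edge_funK e) (edge_fun_revK e).

Lemma edge_permV e : (edge_perm e)^-1 = edge_perm (rev_edge e).
Proof. exact: wpermP. Qed.

(** The graph automaton group, for the orientation [D]. *)
Definition graph_automaton_group D : set (wperm V) :=
  generated [set g | exists2 e, e \in D & g = edge_perm e]%classic.

(** [h] is the restriction of [g] at [x]; see [restriction_exists] and
    [restriction_unique] below. *)
Definition is_restriction (g : wperm V) x (h : wperm V) : Prop :=
  forall w, g (x :: w) = g [:: x] ++ h w.

Definition Stab (G : set (wperm V)) : set (wperm V) :=
  [set g | G g /\ forall x, g [:: x] = [:: x]]%classic.

(** The image of [S] under [psi : g |-> (g_x)_(x in V)]. *)
Definition psi_image (S : set (wperm V)) : set (V -> wperm V) :=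
  [set h | exists2 g, S g & forall x, is_restriction g x (h x)]%classic.

Definition fractal (G : set (wperm V)) : Prop :=
  forall x h, G h -> exists2 g, Stab G g & is_restriction g x h.

Definition weakly_regular_branch (G N : set (wperm V)) : Prop :=
  [/\ is_subgroup N,
      (N `<=` G)%classic,
      exists2 g, N g & g <> 1
    & ([set h : V -> wperm V | forall x, N (h x)]
         `<=` psi_image (N `&` Stab G))%classic].

Definition directed_cycle (s : seq (V * V)) : Prop :=
  exists v : seq V, [/\ 3 <= size v, uniq v & s = zip v (rot 1 v)].

Lemma restriction_unique g x h h' :
  is_restriction g x h -> is_restriction g x h' -> h = h'.
Proof.
move=> gh gh'; apply: wpermP => w.
have /eqP := gh w.
by rewrite gh' eqseq_cat // eqxx => /eqP.
Qed.

Lemma restriction_exists D g x : graph_automaton_group D g ->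
  exists2 h, graph_automaton_group D h & is_restriction g x h.
Proof.
set GG := graph_automaton_group D => Gg.
have [GG1 GGM GGV] : is_subgroup GG by apply: generated_subgroup.
pose sections (k : wperm V) (f : V -> V) := forall z, exists2 h, GG h &
  forall w, k (z :: w) = f z :: h w.
pose M : set (wperm V) :=
  [set k : wperm V | k [::] = [::] /\ exists f, sections k f]%classic.
suff GGM' : forall k, GG k -> M k.
  have [_ [f /(_ x)[h Gh gh]]] := GGM' g Gg; exists h => // w.
  by have [h0 _] := GGM' h Gh; rewrite !gh h0.
move=> k; apply; split; last first.
  move=> _ [e De ->]; split=> //.
  exists (fun z => if z == e.1 then e.2 else if z == e.2 then e.1 else z) => z.
  exists (if z == e.1 then edge_perm e else 1).
    by case: ifP => // _ H [_ sH]; apply: sH; exists e.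
  by move=> w /=; case: (z == e.1) => //; case: (z == e.2).
split.
- by split=> //; exists id => z; exists 1.
- move=> s t [s0 [f sf]] [t0 [f' tf']]; split; first by rewrite wpermM s0.
  exists (f' \o f) => z; have [h Gh sh] := sf z; have [h' Gh' th'] := tf' (f z).
  by exists (h * h'); [apply: GGM | move=> w; rewrite (wpermM s t) sh th'].
- move=> s [s0 [f sf]]; split; first by rewrite wpermV -[in LHS]s0 wfunK.
  have f_inj : injective f.
    move=> z z' ff; have [h _ sh] := sf z; have [h' _ sh'] := sf z'.
    have: s (z :: [::]) = s (z' :: winv h' (h [::])).
      by rewrite sh sh' winvK ff.
    by move/(can_inj (@wfunK _ s)) => -[].
  exists (invF f_inj) => z; have [h Gh sh] := sf (invF f_inj z).
  exists h^-1; first exact: GGV.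
  move=> w; apply: (can_inj (@wfunK _ s)).
  by rewrite sh (wpermV s) (wpermV h) !winvK f_invF.
Qed.

End Graph.

(* Main.v *)
(* An oriented edge e = (x, y) sends xw to y e(w) and yw to xw, so its inverse
   sends yw to x e^-1(w) and xw to yw.  Travelling along edges backwards thus
   moves any letter to any other with trivial section, while e^2 fixes all
   letters and has section e at both ends of e; conjugating gives fractality.
   If xyz is a path, [(x,y), (y,z)] has order 3.  The product of a directed
   cycle based at a fixes a, with section the product itself, and cyclically
   permutes the other vertices of the cycle with trivial sections.
   For the branching property, let K_x be the group of sections at x of the
   elements of the commutator subgroup that act only below x.  It is normal by
   fractality and independent of x by transport, so it suffices that it contains
   [e, f] for any two edges; this is trivial unless e and f meet in exactly one
   vertex v, and then [e^2, f^2] has section [e, f] at v and 1 elsewhere. *)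

Require Import Defs.
From mathcomp Require Import all_boot.
From mathcomp Require Import boolp classical_sets.

Local Open Scope group_scope.

Set Implicit Arguments.
Unset Strict Implicit.
Unset Printing Implicit Defensive.

(** * Commutators of generators *)

Section Subgroups.
Variable G : groupType.
Implicit Types (A H K : set G) (x y : G).

Lemma sub_generated A x : A x -> generated A x.
Proof. by move=> Ax H [_]; apply. Qed.

Lemma generated_ind A H :
  is_subgroup H -> (forall x, A x -> H x) -> forall x, generated A x -> H x.
Proof. by move=> Hsub AH x; apply. Qed.

Lemma subgroupV_mem H x : is_subgroup H -> H x^-1 -> H x.
Proof. by case=> _ _ HV /HV; rewrite invgK. Qed.

Lemma subgroupJ H x y : is_subgroup H -> H x -> H y -> H (x ^ y).
Proof. by case=> _ HM HV Hx Hy; apply: (HM); [apply: HV | apply: HM]. Qed.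

Lemma subgroupR H x y : is_subgroup H -> H x -> H y -> H [~ x, y].
Proof.
move=> Hsub Hx Hy; have [_ HM HV] := Hsub.
by apply: HM; [apply: HV | apply: subgroupJ].
Qed.

Lemma commMgJ x y z : [~ x * y, z] = [~ x, z] ^ y * [~ y, z].
Proof. by rewrite /commg /conjg !gnorm. Qed.

Lemma commVgJ x y : [~ x^-1, y] = [~ x, y]^-1 ^ x^-1.
Proof. by rewrite /commg /conjg !gnorm. Qed.

(** For fixed [b], the elements [x] of the group with [[~ x, b]] in [K] form a subgroup, since [K]
    is stable under conjugation. Hence the condition on generators extends to one argument, then to
    the other. *)
Lemma commutator_subgroup_sub A K :
    is_subgroup K ->
    (forall x y, K x -> generated A y -> K (x ^ y)) ->
    (forall x y, A x -> A y -> K [~ x, y]) ->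
  forall x, commutator_subgroup (generated A) x -> K x.
Proof.
move=> Ksub KJ KA; have [K1 KM KV] := Ksub.
have [G1 GM GV] := generated_subgroup A.
have centr B : (forall x b, A x -> B b -> K [~ x, b]) ->
    forall x b, generated A x -> B b -> K [~ x, b].
  move=> KB x b Gx Bb.
  suff [] : [set g | generated A g /\ K [~ g, b]]%classic x by [].
  apply: generated_ind x Gx => [|x Ax]; last first.
    by split; [apply: sub_generated | apply: KB].
  split=> [|x y [Gx Kx] [Gy Ky]|x [Gx Kx]].
  - by rewrite /= comm1g.
  - by split; [apply: GM | rewrite commMgJ; apply: KM => //; apply: KJ].
  - by split; [apply: GV | rewrite commVgJ; apply: KJ; [apply: KV | apply: GV]].
apply: generated_ind => // _ [x [y [Gx Gy ->]]].
apply: (centr (generated A)) => // {Gx Gy x y} x y Ax Gy.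
(* Inversion swaps the arguments, so [centr] also handles the second one. *)
rewrite -[[~ x, y]]invgK invgR; apply: KV.
by apply: (centr A) => // {Ax Gy x y} x y Ax Ay; apply: KA.
Qed.

End Subgroups.

(** * Sections at a letter, and edge automorphisms *)

Section Sections.
Variable V : finType.
Implicit Types (D : {set V * V}) (x y z : V) (g h k : wperm V) (w : seq V).

(** Naming the target letter [y] lets sections of products be computed by following a letter from
    factor to factor. *)
Definition has_section g x y h := forall w, g (x :: w) = y :: h w.

Lemma has_section1 x : has_section 1 x x 1.
Proof. by []. Qed.

Lemma has_sectionM g g' x y z h h' :
  has_section g x y h -> has_section g' y z h' ->
  has_section (g * g') x z (h * h').
Proof. by move=> gh g'h' w; rewrite wpermM gh g'h'. Qed.

Lemma has_sectionV g x y h : has_section g x y h -> has_section g^-1 y x h^-1.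
Proof.
move=> gh w; apply: (can_inj (@wfunK _ g)).
by rewrite gh !wpermV !winvK.
Qed.

Lemma has_sectionX g x h n :
  has_section g x x h -> has_section (g ^+ n) x x (h ^+ n).
Proof.
move=> gh; elim: n => // n IHn.
by rewrite !expgS; apply: has_sectionM IHn.
Qed.

Lemma has_sectionR g g' x h h' :
  has_section g x x h -> has_section g' x x h' ->
  has_section [~ g, g'] x x [~ h, h'].
Proof.
move=> gh g'h'; apply: has_sectionM (has_sectionV gh) _.
by apply: has_sectionM (has_sectionV g'h') _; apply: has_sectionM g'h'.
Qed.

Lemma eq1_section g :
  g [::] = [::] -> (forall x, has_section g x x 1) -> g = 1.
Proof. by move=> g0 g1; apply: wpermP => -[//|x w]; rewrite g1. Qed.

Lemma edge_section_src x y :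
  has_section (edge_perm (x, y)) x y (edge_perm (x, y)).
Proof. by move=> w /=; rewrite eqxx. Qed.

Lemma edge_section_tgt x y : x != y -> has_section (edge_perm (x, y)) y x 1.
Proof. by move=> xy w /=; rewrite eq_sym (negbTE xy) eqxx. Qed.

Lemma edge_section_id x y z :
  z != x -> z != y -> has_section (edge_perm (x, y)) z z 1.
Proof. by move=> zx zy w /=; rewrite (negbTE zx) (negbTE zy). Qed.

(** Each endpoint crosses the edge and comes back: once from the source, with the edge as section,
    and once from the target, with section 1. *)
Lemma edge_sqr_section x y z : x != y ->
  has_section (edge_perm (x, y) ^+ 2) z z
    (if (z == x) || (z == y) then edge_perm (x, y) else 1).
Proof.
move=> xy; rewrite expgS expg1.
have [->|zx] := eqVneq z x; last have [->|zy] := eqVneq z y.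
- rewrite -[X in has_section _ _ _ X]mulg1.
  exact: has_sectionM (edge_section_src x y) (edge_section_tgt xy).
- rewrite -[X in has_section _ _ _ X]mul1g.
  exact: has_sectionM (edge_section_tgt xy) (edge_section_src x y).
- by apply: (has_sectionM (h := 1) (h' := 1)); apply: edge_section_id.
Qed.

(** An edge automorphism fixes every word whose first letter is off the edge, and keeps first
    letters on the edge; so at most one of two disjoint edges acts on a given word. *)
Lemma edge_perm_commute x y x' y' :
    x != y -> x' != y' -> x' != x -> x' != y -> y' != x -> y' != y ->
  commute (edge_perm (x, y)) (edge_perm (x', y')).
Proof.
move=> xy x'y' x'x x'y y'x y'y; apply: wpermP; elim=> // z w.
rewrite !wpermM /= => IHw.
have [zx|zx] := eqVneq z x.
  have zx' : z != x' by rewrite zx eq_sym.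
  have zy' : z != y' by rewrite zx eq_sym.
  rewrite (negbTE zx') (negbTE zy') /= zx eqxx.
  by rewrite eq_sym (negbTE x'y) [y == y']eq_sym (negbTE y'y).
have [zy|zy] := eqVneq z y.
  have zx' : z != x' by rewrite zy eq_sym.
  have zy' : z != y' by rewrite zy eq_sym.
  rewrite (negbTE zx') (negbTE zy') /= (negbTE zx) zy eqxx.
  by rewrite eq_sym (negbTE x'x) [x == y']eq_sym (negbTE y'x).
have [zx'|zx'] := eqVneq z x'.
  by rewrite /= zx' eqxx (negbTE y'x) (negbTE y'y).
have [zy'|zy'] := eqVneq z y'.
  rewrite /= zy' eqxx (negbTE x'x) (negbTE x'y).
  by rewrite eq_sym (negbTE x'y').
by rewrite /= (negbTE zx) (negbTE zy) (negbTE zx') (negbTE zy').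
Qed.

End Sections.

(** * An element of order three from a path of length two *)

Section Torsion.
Variables (V : finType) (x y z : V).
Hypotheses (xy : x != y) (yz : y != z) (xz : x != z).
Let e := edge_perm (x, y).
Let f := edge_perm (y, z).

Let yx : y != x. Proof. by rewrite eq_sym. Qed.
Let zy : z != y. Proof. by rewrite eq_sym. Qed.
Let zx : z != x. Proof. by rewrite eq_sym. Qed.

Lemma commg_section1 : has_section [~ e, f] x y 1.
Proof.
have e1 := has_sectionV (edge_section_tgt xy).
have f1 := has_sectionV (edge_section_tgt yz).
have := has_sectionM e1 (has_sectionM f1
  (has_sectionM (edge_section_id zx zy) (edge_section_tgt yz))).
by rewrite !gnorm.
Qed.

Lemma commg_section2 : has_section [~ e, f] y z f.
Proof.
have e1 := has_sectionV (edge_section_src x y).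
have f1 := has_sectionV (edge_section_id xy xz).
have := has_sectionM e1 (has_sectionM f1
  (has_sectionM (edge_section_src x y) (edge_section_src y z))).
by rewrite !gnorm.
Qed.

Lemma commg_section3 : has_section [~ e, f] z x f^-1.
Proof.
have e1 := has_sectionV (edge_section_id zx zy).
have f1 := has_sectionV (edge_section_src y z).
have := has_sectionM e1 (has_sectionM f1
  (has_sectionM (edge_section_tgt xy) (edge_section_id xy xz))).
by rewrite !gnorm.
Qed.

Lemma commg_edge_neq1 : [~ e, f] <> 1.
Proof.
move=> ef1; have := commg_section1 [::]; rewrite ef1 wperm1 => -[/eqP].
by rewrite (negbTE xy).
Qed.

(* [~ e, f] permutes x -> y -> z -> x with sections 1, f, f^-1, whose cyclic
   products are trivial. *)
Lemma commg_edge_order3 : [~ e, f] ^+ 3 = 1.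
Proof.
apply: eq1_section => // u.
have [s1 s2 s3] := And3 commg_section1 commg_section2 commg_section3.
have [->|ux] := eqVneq u x.
  by have := has_sectionM s1 (has_sectionM s2 s3); rewrite !gnorm.
have [->|uy] := eqVneq u y.
  by have := has_sectionM s2 (has_sectionM s3 s1); rewrite !gnorm.
have [->|uz] := eqVneq u z.
  by have := has_sectionM s3 (has_sectionM s1 s2); rewrite !gnorm.
have := has_sectionX 3
  (has_sectionR (edge_section_id ux uy) (edge_section_id uy uz)).
by rewrite commgg expg1n.
Qed.

End Torsion.

(** * Products along directed cycles *)

Section Cycles.
Variable V : finType.
Implicit Types (a b d z : V) (s : seq V).

(** This is the product along the walk [a], [s], [b]. Keeping the end [b] apart permits induction on
    open walks; a cycle is the case [b = a]. *)
Definition path_prod a s b : wperm V :=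
  \prod_(e <- zip (a :: s) (rcons s b)) edge_perm e.

Lemma path_prod_nil a b : path_prod a [::] b = edge_perm (a, b).
Proof. by rewrite /path_prod big_seq1. Qed.

Lemma path_prod_cons a d s b :
  path_prod a (d :: s) b = edge_perm (a, d) * path_prod d s b.
Proof. by rewrite /path_prod /= big_cons. Qed.

Lemma path_prod0 a s b : path_prod a s b [::] = [::].
Proof.
elim: s a => [|d s IHs] a; first by rewrite path_prod_nil.
by rewrite path_prod_cons wpermM IHs.
Qed.

(** Every edge meets the travelling letter at its source, so each contributes itself to the
    section. *)
Lemma path_prod_src a s b :
  has_section (path_prod a s b) a b (path_prod a s b).
Proof.
elim: s a => [|d s IHs] a.
  by rewrite path_prod_nil; apply: edge_section_src.
by rewrite path_prod_cons; apply: has_sectionM (IHs d); apply: edge_section_src.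
Qed.

Lemma path_prod_id a s b z :
  z \notin a :: s -> z != b -> has_section (path_prod a s b) z z 1.
Proof.
elim: s a => [|d s IHs] a.
  by rewrite inE path_prod_nil => za zb; apply: edge_section_id.
rewrite !inE !negb_or => /and3P[za zd zs] zb; rewrite path_prod_cons -[1]mul1g.
apply: has_sectionM; first exact: edge_section_id.
by apply: IHs; rewrite // !inE negb_or zd.
Qed.

Lemma path_prod_tgt a s b :
  b \notin a :: s -> has_section (path_prod a s b) b (last a s) 1.
Proof.
elim: s a => [|d s IHs] a.
  by rewrite inE path_prod_nil eq_sym; apply: edge_section_tgt.
rewrite !inE !negb_or => /and3P[ba bd bs]; rewrite path_prod_cons -[1]mul1g.
apply: has_sectionM; first exact: edge_section_id.
by apply: IHs; rewrite // !inE negb_or bd.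
Qed.

(** The first edge to touch this vertex is the one entering it, which takes it back to its
    predecessor with section 1. No later edge touches the predecessor, as it differs from [b]. *)
Lemma path_prod_nth a s b z0 i :
    uniq (a :: s) -> b \notin s -> i < size s -> nth z0 (a :: s) i != b ->
  has_section (path_prod a s b) (nth z0 s i) (nth z0 (a :: s) i) 1.
Proof.
elim: s a i => [|d s IHs] a i //.
rewrite [uniq _]/= [b \in _]inE negb_or => /andP[ads ds] /andP[bd bs].
have ad : a != d by apply: contraNneq ads => ->; rewrite inE eqxx.
rewrite path_prod_cons -[1]mul1g; case: i => [_ ab|i lti pb].
  by apply: has_sectionM (path_prod_id _ ab); first exact: edge_section_tgt.
apply: has_sectionM; last by apply: IHs => //.
have zs : nth z0 s i \in s by apply: mem_nth.
apply: edge_section_id => /=; last first.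
  by apply: contraTneq zs => ->; case/andP: ds.
by apply: contraNneq ads => <-; rewrite inE zs orbT.
Qed.

Section CycleOrder.
Variables (a : V) (s : seq V).
Hypothesis as_uniq : uniq (a :: s).
Let c := path_prod a s a.

Lemma cycle_section_nth i : 0 < size s ->
  has_section c (nth a s (i.+1 %% size s)) (nth a s (i %% size s)) 1.
Proof.
move=> s_gt0; have /andP[a_s s_uniq] := as_uniq.
set n := size s in s_gt0 *; have ltin := ltn_pmod i s_gt0.
have -> : i.+1 %% n = (i %% n).+1 %% n by rewrite -[in RHS]addn1 modnDml addn1.
move: (i %% n) ltin => {}i; rewrite leq_eqVlt => /predU1P[i_n|lti]; last first.
  rewrite modn_small //; apply: (@path_prod_nth a s a a i.+1) => //.
  by apply: contraNneq a_s => <-; apply/mem_nth/ltnW.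
(* Wrap-around: the first edge takes [d] back to [a], and the rest of the walk takes its end [a] to
   the last vertex. *)
rewrite i_n modnn /c; case: s as_uniq a_s @n s_gt0 i_n => // d s' _ a_s n _ i_n.
have -> : nth a (d :: s') i = last d s'.
  by rewrite (last_nth a) -[i]/i.+1.-1 i_n.
have ad : a != d by apply: contraNneq a_s => ->; rewrite inE eqxx.
rewrite path_prod_cons -[1]mul1g.
by apply: has_sectionM (path_prod_tgt a_s); first exact: edge_section_tgt.
Qed.

Lemma cycle_prod_order : 0 < size s -> c ^+ size s = 1.
Proof.
move=> s_gt0; have cX k i :
    has_section (c ^+ k) (nth a s ((i + k) %% size s))
                         (nth a s (i %% size s)) 1.
  elim: k => [|k IHk]; first by rewrite addn0; apply: has_section1.
  rewrite expgS -[1]mul1g addnS; apply: has_sectionM IHk.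
  exact: cycle_section_nth.
have c0 k : (c ^+ k) [::] = [::].
  by elim: k => // k IHk; rewrite expgS wpermM [c _]path_prod0.
apply: wpermP; elim=> [|z w IHw]; first by rewrite c0.
(* At [a] the section of [c] is [c] itself, so this case recurses on the tail of the word; letters
   of [s] return after a full turn with section 1. *)
have [->|za] := eqVneq z a.
  by rewrite (has_sectionX (size s) (@path_prod_src a s a)) IHw.
have [zs|zs] := boolP (z \in s).
  have := cX (size s) (index z s) w.
  by rewrite modnDr modn_small ?index_mem // nth_index.
have zas : z \notin a :: s by rewrite inE negb_or za.
by rewrite (has_sectionX (size s) (path_prod_id zas za)) expg1n.
Qed.

End CycleOrder.

Lemma directed_cycle_prod (l : seq (V * V)) :
  directed_cycle l -> (\prod_(e <- l) edge_perm e) ^+ (size l - 1) = 1.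
Proof.
case=> [[|a s]] [s_gt1 as_uniq ->] //.
(* Rotating [a :: s] gives [rcons s a], so the product is [path_prod a s a] and the exponent is
   [size s]. *)
rewrite size1_zip ?size_rot // rot1_cons subn1.
by apply: cycle_prod_order => //; case: (s) s_gt1.
Qed.

End Cycles.

(** * Fractality and the branching property *)

Section Branching.
Variables (V : finType) (adj : rel V) (D : {set V * V}).
Hypotheses (adj_sym : symmetric adj) (adj_irr : irreflexive adj).
Hypothesis adj_conn : forall x y : V, connect adj x y.
Hypothesis D_or : orientation adj D.
Implicit Types (x y z : V) (g h k : wperm V) (w : seq V).

Let GG := graph_automaton_group D.
Let GG' := commutator_subgroup GG.

Let GGsub : is_subgroup GG. Proof. exact: generated_subgroup. Qed.
Let GG'sub : is_subgroup GG'. Proof. exact: generated_subgroup. Qed.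

Lemma adj_neq x y : adj x y -> x != y.
Proof. by apply: contraTneq => ->; rewrite adj_irr. Qed.

Lemma adj_mem_group x y : adj x y -> GG (edge_perm (x, y)).
Proof.
rewrite (proj1 D_or) => /orP[Dxy|Dyx].
  by apply: sub_generated; exists (x, y).
apply: (subgroupV_mem GGsub); rewrite edge_permV.
by apply: sub_generated; exists (y, x).
Qed.

Lemma orientation_neq x y : (x, y) \in D -> x != y.
Proof. by move=> Dxy; apply: adj_neq; rewrite (proj1 D_or) Dxy. Qed.

Lemma size_group g w : GG g -> size (g w) = size w.
Proof.
move=> Gg; move: w.
suff: [set g : wperm V | forall w, size (g w) = size w]%classic g by [].
apply: generated_ind g Gg => [|_ [e _ ->]].
  split=> [//|g h sg sh w|g sg w]; first by rewrite wpermM sh sg.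
  by rewrite -[in RHS](winvK g w) sg.
by elim=> //= z w IHw; do 2?case: ifP => _ //=; rewrite IHw.
Qed.

Lemma group_nil g : GG g -> g [::] = [::].
Proof. by move=> Gg; apply: size0nil; rewrite size_group. Qed.

Lemma commutator_sub_group g : GG' g -> GG g.
Proof.
by apply: generated_ind => // _ [x [y [Gx Gy ->]]]; apply: (subgroupR GGsub).
Qed.

Lemma commg_mem g h : GG g -> GG h -> GG' [~ g, h].
Proof. by move=> Gg Gh; apply: sub_generated; exists g, h. Qed.

Lemma commutatorJ g h : GG' g -> GG h -> GG' (g ^ h).
Proof.
(* Here [g ^ h] is rewritten as [g * [~ g, h]]. *)
move=> G'g Gh; rewrite -[g ^ h](mulVKg g); have [_ GM _] := GG'sub.
by apply: GM => //; apply: commg_mem => //; apply: commutator_sub_group.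
Qed.

Lemma group_transport x y : exists2 g, GG g & has_section g x y 1.
Proof.
have [G1 GM _] := GGsub.
have /connectP[p] := adj_conn x y; elim: p x => [|z p IHp] x /=.
  by move=> _ ->; exists 1.
(* The edge is [(z, x)], so that [x] is its target and has section 1. *)
move=> /andP[xz /IHp{}IHp] /IHp[g Gg gz]; exists (edge_perm (z, x) * g).
  by apply: GM => //; apply: adj_mem_group; rewrite adj_sym.
rewrite -[1]mul1g; apply: has_sectionM gz.
by apply: edge_section_tgt; apply: adj_neq; rewrite adj_sym.
Qed.

Lemma Stab_subgroup : is_subgroup (Stab GG).
Proof.
have [G1 GM GV] := GGsub; split=> // [g h [Gg g1] [Gh h1]|g [Gg g1]].
  by split=> [|x]; [apply: GM | rewrite wpermM g1].
by split=> [|x]; [apply: GV | rewrite -{1}(g1 x) wpermV wfunK].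
Qed.

Lemma StabJ g h : Stab GG g -> GG h -> Stab GG (g ^ h).
Proof.
move=> [Gg g1] Gh; split=> [|x]; first exact: (subgroupJ GGsub).
have [_ _ GV] := GGsub.
rewrite !wpermM; have := size_group [:: x] (GV h Gh).
by case E: (_ [:: x]) => [|y []] // _; rewrite g1 -E wpermV winvK.
Qed.

(** The attainable [h] form a subgroup. A generator is the section at its source [a] of its own
    square; conjugating by a transport from [a] to [x] moves it to [x] unchanged. *)
Lemma Stab_section x h :
  GG h -> exists2 g, Stab GG g & has_section g x x h.
Proof.
move=> Gh.
suff: [set h | exists2 g, Stab GG g & has_section g x x h]%classic h by [].
have [S1 SM SV] := Stab_subgroup.
apply: generated_ind h Gh => [|_ [[a b] Dab ->]].
  split=> [|h h' [g Sg gh] [g' Sg' gh']|h [g Sg gh]].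
  - by exists 1.
  - by exists (g * g'); [apply: SM | apply: has_sectionM gh'].
  - by exists g^-1; [apply: SV | apply: has_sectionV].
have ab := orientation_neq Dab.
have [p Gp pax] := group_transport a x.
have eS : Stab GG (edge_perm (a, b) ^+ 2).
  split=> [|z]; last by rewrite edge_sqr_section //; case: ifP.
  by have [_ GM _] := GGsub; apply: GM; apply: sub_generated; exists (a, b).
exists ((edge_perm (a, b) ^+ 2) ^ p); first exact: StabJ.
have ea := edge_sqr_section a ab; rewrite eqxx /= in ea.
have := has_sectionM (has_sectionV pax) (has_sectionM ea pax).
by rewrite !gnorm.
Qed.

Lemma section_is_restriction g x h :
  GG h -> has_section g x x h -> is_restriction g x h.
Proof. by move=> Gh gh w; rewrite !gh group_nil. Qed.

Lemma fractal_group : fractal GG.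
Proof.
move=> x h Gh; have [g Sg gh] := Stab_section x Gh.
by exists g => //; apply: section_is_restriction.
Qed.

(** These are the sections at [x] of the rigid stabilizer of the vertex [x] in the commutator
    subgroup. *)
Definition rigid_section x : set (wperm V) :=
  [set h | exists g, [/\ GG' g, has_section g x x h
                       & forall z, z != x -> has_section g z z 1]]%classic.

Lemma rigid_section_subgroup x : is_subgroup (rigid_section x).
Proof.
have [G1 GM GV] := GG'sub.
split=> [|h h' [g [Gg gh g1]] [g' [Gg' gh' g1']]|h [g [Gg gh g1]]].
- by exists 1.
- exists (g * g'); split; [exact: GM | exact: has_sectionM gh' |].
  by move=> z zx; rewrite -[1]mul1g; apply: has_sectionM (g1' z zx); apply: g1.
- exists g^-1; split; [exact: GV | exact: has_sectionV |].
  by move=> z zx; rewrite -invg1; apply/has_sectionV/g1.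
Qed.

(** With [y = x] this gives normality, and with [u = 1] independence of the vertex. *)
Lemma rigid_sectionJ x y p u h :
  GG p -> has_section p x y u -> rigid_section x h -> rigid_section y (h ^ u).
Proof.
move=> Gp pu [g [Gg gh g1]]; exists (g ^ p); split; first exact: commutatorJ.
  by apply: has_sectionM (has_sectionV pu) _; apply: has_sectionM pu.
move=> z zy w; have [_ _ GV] := GGsub.
rewrite !wpermM; have := size_group (z :: w) (GV p Gp).
case E: (_ (z :: w)) => [|z' w'] // _.
have Ep : p (z' :: w') = z :: w by rewrite -E wpermV winvK.
(* If [p^-1] sent [z] to [x], then [p] would send [x] to both [z] and [y]. *)
have [z'x|z'x] := eqVneq z' x; last by rewrite (g1 _ z'x).
by move: Ep zy; rewrite z'x pu => -[->]; rewrite eqxx.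
Qed.

Lemma rigid_section_edges x e f :
  e \in D -> f \in D -> rigid_section x [~ edge_perm e, edge_perm f].
Proof.
case: e f => [a b] [c d] Dab Dcd.
have [ab cd] := (orientation_neq Dab, orientation_neq Dcd).
set g := [~ edge_perm (a, b), edge_perm (c, d)].
have trivial : commute (edge_perm (a, b)) (edge_perm (c, d)) ->
    rigid_section x g.
  move/commgP/eqP => g1; rewrite /g g1.
  by have [K1 _ _] := rigid_section_subgroup x; apply: K1.
suff [|[y gy]] : commute (edge_perm (a, b)) (edge_perm (c, d)) \/
    exists y, rigid_section y g; first exact: trivial.
  have [p Gp pyx] := group_transport y x.
  by rewrite -[g]conjg1; apply: rigid_sectionJ pyx gy.
(* At each vertex common to both edges k has section g, elsewhere 1; if there
   is not exactly one common vertex then the two edge automorphisms commute. *)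
pose k := [~ edge_perm (a, b) ^+ 2, edge_perm (c, d) ^+ 2].
have Gk : GG' k.
  have [_ GM _] := GGsub.
  by apply: commg_mem; apply: GM; apply: sub_generated;
    [exists (a, b) | exists (a, b) | exists (c, d) | exists (c, d)].
have sk z := has_sectionR (edge_sqr_section z ab) (edge_sqr_section z cd).
have [ca|ca] := boolP ((c == a) || (c == b));
  have [da|da] := boolP ((d == a) || (d == b)).
(* The second edge is the first one or its reverse, hence its automorphism is the same or the
   inverse. *)
- left; case/orP: ca da cd => /eqP-> /orP[] /eqP->; rewrite ?eqxx // => _.
  by rewrite -[(b, a)]/(rev_edge (a, b)) -edge_permV; apply/commuteV.
- right; exists c, k; split=> // [|z zc].
    by have := sk c; rewrite ca eqxx.
  have := sk z; rewrite (negbTE zc) /=; have [->|_] := eqVneq z d.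
    by rewrite (negbTE da) comm1g.
  by rewrite commg1.
- right; exists d, k; split=> // [|z zd].
    by have := sk d; rewrite da eqxx orbT.
  have := sk z; rewrite (negbTE zd) orbF; have [->|_] := eqVneq z c.
    by rewrite (negbTE ca) comm1g.
  by rewrite commg1.
- by left; move: ca da; rewrite !negb_or => /andP[? ?] /andP[? ?];
    apply: edge_perm_commute.
Qed.

Lemma commutator_rigid_section x h : GG' h -> rigid_section x h.
Proof.
apply: commutator_subgroup_sub h; first exact: rigid_section_subgroup.
  move=> h u Kh Gu; have [g [Gg _] gu] := Stab_section x Gu.
  exact: rigid_sectionJ gu Kh.
by move=> _ _ [e De ->] [f Df ->]; apply: rigid_section_edges.
Qed.

(** For each vertex [x], some commutator-subgroup element acts only below [x] with section [h x];
    their product over all vertices has every prescribed section. *)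
Lemma commutator_psi_image (h : V -> wperm V) :
  (forall x, GG' (h x)) -> psi_image (GG' `&` Stab GG)%classic h.
Proof.
move=> G'h; have [G1 GM GV] := GG'sub.
suff [g [Gg gh]] : exists g, GG' g /\ forall x, has_section g x x (h x).
  have Gh x : GG (h x) by apply: commutator_sub_group.
  exists g => [|x]; last exact: section_is_restriction.
  split=> //; split=> [|x]; first exact: commutator_sub_group.
  by rewrite gh group_nil.
suff /(_ _ (enum_uniq V))[g [Gg gh]] : forall s : seq V, uniq s -> exists g,
    GG' g /\ forall x, has_section g x x (if x \in s then h x else 1).
  by exists g; split=> // x; have := gh x; rewrite mem_enum.
elim=> [_|y s IHs /= /andP[ys /IHs[g [Gg gh]]]]; first by exists 1.
have [k [Gk ky k1]] := commutator_rigid_section y (G'h y).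
exists (k * g); split=> [|x]; first exact: GM.
rewrite inE; have [->|xy] := eqVneq x y.
  by have := has_sectionM ky (gh y); rewrite (negbTE ys) mulg1.
by have := has_sectionM (k1 x xy) (gh x); rewrite mul1g.
Qed.

(** Otherwise each vertex has at most one neighbour, so the ends of an edge are closed under
    adjacency; by connectedness they are all of [V], leaving a single edge. *)
Lemma two_path : 2 <= #|edge_set adj| ->
  exists x y z, [/\ adj x y, adj y z & x != z].
Proof.
move=> two; apply: contrapT => no.
have deg1 x y z : adj x y -> adj y z -> z = x.
  by move=> xy yz; apply: contrapT => zx; apply: no; exists x, y, z; split=> //;
    apply/eqP => /esym.
have /card_gt0P[_ /imsetP[[a b] /= ab _]] : 0 < #|edge_set adj|.
  exact: leq_trans two.
rewrite inE /= in ab.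
have cl y : (y == a) || (y == b).
  have closed : fingraph.closed adj (pred2 a b).
    apply: (intro_closed (sym_connect_sym adj_sym)) => x z xz.
    case/orP=> /eqP x_; rewrite x_ in xz.
      rewrite adj_sym in ab; rewrite (deg1 _ _ _ ab xz); exact: predU1r.
    by rewrite (deg1 _ _ _ ab xz); apply: predU1l.
  by have := closed_connect closed (adj_conn a y); rewrite !inE eqxx.
move: two; rewrite leqNgt => /negP[].
rewrite ltnS -(cards1 [set a; b]); apply/subset_leq_card/fintype.subsetP => E.
case/imsetP => [[x y]]; rewrite !inE /= => /adj_neq xy ->.
by move: (cl x) (cl y) xy => /orP[] /eqP-> /orP[] /eqP->;
  rewrite ?eqxx // finset.setUC.
Qed.

End Branching.

Theorem theorem3p1 (V : finType) (adj : rel V) (D : {set V * V})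
    (adj_sym : symmetric adj) (adj_irr : irreflexive adj)
    (adj_conn : forall x y : V, connect adj x y)
    (two_edges : 2 <= #|edge_set adj|)
    (D_or : orientation adj D) :
  let GG : set (wperm V) := graph_automaton_group D in
  [/\ fractal GG,
      (exists g : wperm V,
         [/\ GG g, g <> 1 & exists2 n : nat, 0 < n & g ^+ n = 1]) /\
      (exists g h : wperm V, [/\ GG g, GG h & g * h <> h * g]),
      (forall (t : nat) (e : 'I_t -> V * V) (eps : 'I_t -> bool),
         (forall i, e i \in D) ->
         directed_cycle
           [seq (if eps i then e i else rev_edge (e i)) | i <- enum 'I_t] ->
         (\prod_(i < t)
            (if eps i then edge_perm (e i) else (edge_perm (e i))^-1))
           ^+ (t - 1) = 1)
    & weakly_regular_branch GG (commutator_subgroup GG)].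
Proof.
move=> GG; have GGsub : is_subgroup GG by apply: generated_subgroup.
have [x [y [z [xy yz xz]]]] := two_path adj_sym adj_irr adj_conn two_edges.
have [Ge Gf] := (adj_mem_group D_or xy, adj_mem_group D_or yz).
have [nxy nyz] := (adj_neq adj_irr xy, adj_neq adj_irr yz).
have ef_neq1 := commg_edge_neq1 nxy nyz xz.
split.
- exact: fractal_group adj_sym adj_irr adj_conn D_or.
- split.
    exists [~ edge_perm (x, y), edge_perm (y, z)].
    by split; [apply: (subgroupR GGsub) | | exists 3];
      last exact: commg_edge_order3.
  exists (edge_perm (x, y)), (edge_perm (y, z)); split=> //.
  by move=> /commgP/eqP.
- move=> t e eps _ /directed_cycle_prod; rewrite size_map size_enum_ord big_map.
  (* Unfolding the index list of the product over ['I_t] matches it with the list in the directed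
     cycle. *)
  rewrite [index_enum _]unlock -enumT => cycle1.
  rewrite -[RHS]cycle1; congr (_ ^+ _).
  by apply: eq_bigr => i _; rewrite edge_permV; case: ifP.
- split; [exact: generated_subgroup | exact: commutator_sub_group | |].
    by exists [~ edge_perm (x, y), edge_perm (y, z)] => //; apply: commg_mem.
  exact: commutator_psi_image adj_sym adj_irr adj_conn D_or.
Qed.
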